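(* Let $G$ be a convex bipartite graph satisfying Property A. Then $G$ has a Hamiltonian cycle.
   Context: All graphs are finite, simple, connected and unweighted. A convex bipartite graph is a bipartite graph $G$ with bipartition $(X,Y)$ together with an ordering $X=(x_1,\ldots,x_n)$ such that for every $y\in Y$ the neighborhood $N_G(y)$ consists of consecutive vertices of this ordering; $n=|X|$. For $1\le p<q\le n$ let $X_{p..q}=\{x_p,\ldots,x_q\}$, $N_G[X_{p..q}]=\{y\in Y : N_G(y)\subseteq X_{p..q}\}$ and $N'_G[X_{p..q}]=\{y\in Y : |N_G(y)\cap X_{p..q}|\ge 2\}$. $G$ satisfies Property A if: (1) for all $1\le p<q\le n$ with $(p,q)\neq(1,n)$, $|N_G[X_{p..q}]|\le q-p$; (2) for every integer $j\in\{1,\ldots,n-1\}$ and all indices with $1\le p_1<q_1\le p_2<q_2\le\cdots\le p_j<q_j\le n$, $\left|\bigcup_{i=1}^j N'_G[X_{p_i..q_i}]\right|\ge\sum_{i=1}^j (q_i-p_i)$; (3) $|N_G[X_{1..n}]|=|N'_G[X_{1..n}]|=n$. *)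

(* Defs.v *)
From mathcomp Require Import all_boot.

Set Implicit Arguments.
Unset Strict Implicit.
Unset Printing Implicit Defensive.

Record sgraph := SGraph {
  vertex :> finType;
  edge : rel vertex;
  edge_sym : symmetric edge;
  edge_irrefl : irreflexive edge
}.

Definition neighborhood (G : sgraph) (v : G) : {set G} := [set u | edge v u].

(* The null graph does not count as connected. *)
Definition connected (G : sgraph) : Prop :=
  0 < #|G| /\ forall u v : G, connect (@edge G) u v.

Definition bipartition (G : sgraph) (X Y : {set G}) : Prop :=
  [/\ X :|: Y = [set: G], [disjoint X & Y]
    & forall u v : G, edge u v -> (u \in X) = (v \in Y)].

(* The ordering (x_1, ..., x_n) of X, with n = #|X|, is given by
   x : 'I_#|X| -> G; since ordinals start at 0, x_k is x i with i.+1 = k. *)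
Definition ordering (G : sgraph) (X : {set G}) (x : 'I_#|X| -> G) : Prop :=
  injective x /\ [set x i | i : 'I_#|X|] = X.

(* X_{p..q} = {x_p, ..., x_q}, with the indices p and q starting at 1. *)
Definition Xint (G : sgraph) (X : {set G}) (x : 'I_#|X| -> G) (p q : nat) :
  {set G} := [set x i | i : 'I_#|X| & p <= i.+1 <= q].

Definition convex_bipartite (G : sgraph) (X Y : {set G})
    (x : 'I_#|X| -> G) : Prop :=
  [/\ bipartition X Y, ordering x
    & forall y, y \in Y -> exists p q : nat, neighborhood y = Xint x p q].

Definition Nclosed (G : sgraph) (X Y : {set G}) (x : 'I_#|X| -> G)
    (p q : nat) : {set G} :=
  [set y in Y | neighborhood y \subset Xint x p q].

Definition Nprime (G : sgraph) (X Y : {set G}) (x : 'I_#|X| -> G)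
    (p q : nat) : {set G} :=
  [set y in Y | 2 <= #|neighborhood y :&: Xint x p q|].

Definition propertyA (G : sgraph) (X Y : {set G}) (x : 'I_#|X| -> G) : Prop :=
  let n := #|X| in
  [/\ forall p q : nat, 1 <= p -> p < q -> q <= n -> (p, q) <> (1, n) ->
        #|Nclosed Y x p q| <= q - p,
      (* only the values p_i and q_i with 1 <= i <= j matter *)
      forall (j : nat) (p q : nat -> nat),
        1 <= j <= n - 1 ->
        (forall i, 1 <= i <= j -> 1 <= p i /\ p i < q i <= n) ->
        (forall i, 1 <= i < j -> q i <= p i.+1) ->
        \sum_(1 <= i < j.+1) (q i - p i)
          <= #|\bigcup_(1 <= i < j.+1) Nprime Y x (p i) (q i)|
    & #|Nclosed Y x 1 n| = n /\ #|Nprime Y x 1 n| = n].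

(* ucycle alone would accept an edge traversed back and forth, which is not a
   cycle of a simple graph; hence the bound on the length. *)
Definition hamiltonian (G : sgraph) : Prop :=
  exists c : seq G,
    [/\ 3 <= size c, ucycle (@edge G) c & forall v : G, v \in c].

(* Main.v *)
Require Import Defs.
From mathcomp Require Import all_boot.
From mathcomp Require Import zify.

(** Sweep the vertices x_0, ..., x_(n-1) from left to right, keeping a path that
    covers x_0, ..., x_k and k vertices of Y, with ends x_k and some x_u.  To pass
    from x_k to x_(k+1), spend the unused neighbour y of x_k whose interval ends
    first.  Conditions (1) and (3) guarantee, as in earliest-deadline-first
    scheduling, that no unused vertex of Y ever expires and that x_k always has at
    least two unused neighbours.  One unused common neighbour z of x_u and x_k is
    held in reserve to close the cycle: if y <> z, then y joins x_k to x_(k+1);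
    if y = z, then z joins x_u to x_(k+1), the ends become x_k and x_(k+1), and
    another unused neighbour of x_k becomes the reserve.  Condition (2) is a
    consequence of the other two. *)

Section Sweep.

Set Implicit Arguments.
Unset Strict Implicit.

Variables (T : finType) (e : rel T) (n : nat) (x : nat -> T) (Y : {set T}).

(** The counterpart of [Nclosed], with indices from 0; since [x] is total on [nat], only [i < n]
    counts. *)
Definition within (p q : nat) : {set T} :=
  [set y in Y | [forall i : 'I_n, e y (x i) ==> (p <= i <= q)]].

Lemma withinP p q y :
  reflect (y \in Y /\ forall i, i < n -> e y (x i) -> p <= i <= q)
          (y \in within p q).
Proof.
rewrite inE; apply: (iffP andP) => -[yY h]; split=> //.
  by move=> i lt_in; move/forallP/(_ (Ordinal lt_in))/implyP: h.
by apply/forallP=> i; apply/implyP; apply: h.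
Qed.

Hypothesis e_sym : symmetric e.
Hypothesis n_gt1 : 1 < n.
Hypothesis xY : forall i, i < n -> x i \notin Y.
Hypothesis x_inj : {in gtn n &, injective x}.
Hypothesis convex : forall y i j k, y \in Y -> i <= j <= k -> k < n ->
  e y (x i) -> e y (x k) -> e y (x j).
Hypothesis card_Y : #|Y| = n.
(** Condition (1), extended to [p = q], where it says that no vertex of [Y] has fewer than two
    neighbours among the [x i]. *)
Hypothesis sparse : forall p q, p <= q -> q < n -> (p, q) <> (0, n.-1) ->
  #|within p q| <= q - p.

Definition right_end (y : T) : nat := \max_(i < n | e y (x i)) i.

Lemma leq_right_end y i : i < n -> e y (x i) -> i <= right_end y.
Proof. by move=> lt_in; apply: (@leq_bigmax_cond _ _ _ (Ordinal lt_in)). Qed.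

Lemma right_end_within y q : y \in Y -> right_end y <= q -> y \in within 0 q.
Proof.
move=> yY le_q; apply/withinP; split=> // i lt_in /(leq_right_end lt_in) le_i.
exact: leq_trans le_i le_q.
Qed.

(* [U] is the set of vertices of Y unused on reaching x_k; the last clause is the
   condition under which they can still all be used before expiring. *)
Definition feasible (U : {set T}) (k : nat) : Prop :=
  [/\ U \subset Y, #|U| = n - k
    & forall q, k <= q -> q.+1 < n -> #|U :&: within 0 q| <= q - k].

Lemma feasible0 : feasible Y 0.
Proof.
split=> [||q _ lt_qn]; rewrite ?subn0 //.
rewrite (leq_trans (subset_leq_card (subsetIr _ _))) //.
rewrite -[leqRHS]subn0; apply: sparse => //; first exact: ltnW.
by case; lia.
Qed.

(** Without a neighbour beyond [x k], [y] would lie in [U :&: within 0 k], which feasibility at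
    [q = k] makes empty. Convexity does the rest. *)
Lemma feasible_reach U k y i : feasible U k -> k.+1 < n -> y \in U -> i <= k ->
  e y (x i) -> e y (x k.+1).
Proof.
move=> [sUY _ early] lt_kn yU le_ik eyi.
have yY := subsetP sUY y yU.
have [/existsP [j /andP [eyj lt_kj]] | noj] :=
  boolP [exists j : 'I_n, e y (x j) && (k < j)].
  by apply: (convex yY _ (ltn_ord j) eyi eyj); lia.
have: y \in U :&: within 0 k.
  rewrite inE yU; apply/withinP; split=> // j lt_jn eyj; rewrite /= leqNgt.
  apply: contra noj => lt_kj; apply/existsP.
  by exists (Ordinal lt_jn); rewrite eyj.
have := early k (leqnn k) lt_kn; rewrite subnn leqn0 cards_eq0 => /eqP ->.
by rewrite inE.
Qed.

(** A neighbour before [x k] would force [x k.+1] by [feasible_reach], hence [x k] by convexity. *)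
Lemma not_adjacent_within U k q y : feasible U k -> k.+1 < n -> y \in U ->
    ~~ e y (x k) -> (forall i, i < n -> e y (x i) -> i <= q) ->
  y \in within k.+1 q.
Proof.
move=> feasU lt_kn yU n_eyk le_q; have [sUY _ _] := feasU.
have yY := subsetP sUY y yU.
apply/withinP; split=> // i lt_in eyi; rewrite (le_q i) // andbT ltnNge.
apply: contra n_eyk => le_ik.
have eyk1 := feasible_reach feasU lt_kn yU le_ik eyi.
by apply: (convex yY _ lt_kn eyi eyk1); rewrite le_ik leqnSn.
Qed.

(** At most [n - k - 2] of the [n - k] vertices of [U] miss [x k], since those lie in
    [within k.+1 n.-1]. Two are needed: one to move on, one as reserve. *)
Lemma card_queue U k : feasible U k -> k.+1 < n ->
  1 < #|[set y in U | e y (x k)]|.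
Proof.
move=> feasU lt_kn; have [_ cardU _] := feasU.
have sub : U \subset [set y in U | e y (x k)] :|: within k.+1 n.-1.
  apply/subsetP=> y yU; rewrite in_setU inE yU /=.
  have [//|n_eyk /=] := boolP (e y (x k)).
  by apply: (not_adjacent_within feasU) => // i; lia.
have := subset_leq_card sub; have := @sparse k.+1 n.-1.
case: (leq_card_setU [set y in U | e y (x k)] (within k.+1 n.-1)).
have H : (k.+1, n.-1) <> (0, n.-1) by [].
move=> + _ /(_ _ _ H); lia.
Qed.

Lemma feasible_step U k : feasible U k -> k.+1 < n ->
  exists y, [/\ y \in U, e y (x k) & feasible (U :\ y) k.+1].
Proof.
move=> feasU lt_kn; have [sUY cardU early] := feasU.
have /card_gt0P [y0] := ltnW (card_queue feasU lt_kn); rewrite inE => y0Q.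
have [y /andP [yU eyk] y_min] :=
  @arg_minnP _ y0 (fun y => (y \in U) && e y (x k)) right_end y0Q.
have card_rem := cardsD1 y U; rewrite yU cardU in card_rem.
exists y; split=> //; split; first exact: subset_trans (subD1set _ _) sUY.
  by lia.
move=> q lt_kq lt_qn.
have [y_early | y_late] := boolP (y \in within 0 q).
  have := early q (ltnW lt_kq) lt_qn.
  rewrite (cardsD1 y) in_setI yU y_early setIDAC; lia.
have sub : (U :\ y) :&: within 0 q \subset within k.+1 q.
  apply/subsetP=> w /setIP [/setD1P [_ wU] /withinP [wY w_le]].
  apply: (not_adjacent_within feasU) => //.
  apply: contra y_late => ewk; apply: right_end_within.
    exact: subsetP sUY y yU.
  apply: leq_trans (y_min w _) _; first by rewrite wU.
  by apply/bigmax_leqP=> i; apply: w_le.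
rewrite (leq_trans (subset_leq_card sub)) // sparse //; exact: ltnW.
Qed.

(* [z] is the reserve; [x u] is the other end of the path. *)
Definition swept (k : nat) : Prop := exists s u (U : {set T}) z,
  [/\ [/\ path e (x k) s, last (x k) s = x u & u <= k],
      uniq (x k :: s),
      forall v, (v \in x k :: s) =
        [exists i : 'I_n, (i <= k) && (v == x i)] || (v \in Y :\: U),
      feasible U k
    & [/\ z \in U, e z (x u) & e z (x k)]].

Lemma swept0 : swept 0.
Proof.
have /ltnW/card_gt0P [z] := card_queue feasible0 n_gt1.
rewrite inE => /andP [zY ez0].
exists [::], 0, Y, z; split=> //; last exact: feasible0.
move=> v; rewrite setDv in_set0 orbF inE; apply/eqP/existsP => [-> | [i]].
  by exists (Ordinal (ltnW n_gt1)); rewrite /= eqxx.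
by rewrite leqn0 => /andP [/eqP -> /eqP].
Qed.

(* Both cases prepend x_(k+1) and y to a path [t] with the same vertices as the
   current one, namely that path or its reversal. *)
Lemma sweep_cons k (t : seq T) U y :
    k.+1 < n -> uniq t ->
    (forall v, (v \in t) =
        [exists i : 'I_n, (i <= k) && (v == x i)] || (v \in Y :\: U)) ->
    U \subset Y -> y \in U ->
  uniq [:: x k.+1, y & t] /\
  forall v, (v \in [:: x k.+1, y & t]) =
    [exists i : 'I_n, (i <= k.+1) && (v == x i)] || (v \in Y :\: (U :\ y)).
Proof.
move=> lt_kn t_uniq t_mem sUY yU; have yY := subsetP sUY y yU.
have n_yx i : i < n -> y != x i.
  by move=> lt_in; apply: contraNneq (xY lt_in) => <-.
split=> [|v].
  rewrite /= t_uniq andbT inE negb_or eq_sym n_yx //= !t_mem !inE yU /= orbF.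
  rewrite (negbTE (xY lt_kn)) andbF orbF.
  apply/andP; split; apply/existsPn=> i; rewrite negb_and.
    have [le_ik /=|//] := boolP (i <= k).
    apply/eqP=> /x_inj; rewrite !inE lt_kn ltn_ord => /(_ isT isT); lia.
  by rewrite n_yx ?orbT.
rewrite !in_cons t_mem !inE.
have -> : [exists i : 'I_n, (i <= k.+1) && (v == x i)] =
    (v == x k.+1) || [exists i : 'I_n, (i <= k) && (v == x i)].
  apply/existsP/orP=> [[i /andP [le_ik v_xi]] | [v_x | /existsP [i]]].
  - have [le_i|lt_i] := leqP i k.
      by right; apply/existsP; exists i; rewrite le_i.
    by left; rewrite (_ : k.+1 = i) //; lia.
  - by exists (Ordinal lt_kn); rewrite leqnn.
  - by move=> /andP [le_ik v_xi]; exists i; rewrite v_xi leqW.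
rewrite -!orbA; congr (_ || _).
by have [-> | //] := eqVneq v y; rewrite yY orbT.
Qed.

Lemma swept_step k : k.+1 < n -> swept k -> swept k.+1.
Proof.
move=> lt_kn [s [u [U [z [[s_path s_last le_uk] s_uniq s_mem feasU]]]]].
move=> [zU ezu ezk]; have [sUY _ _] := feasU.
have reach := feasible_reach feasU lt_kn.
have [y [yU eyk feasU']] := feasible_step feasU lt_kn.
have [eq_yz | neq_yz] := eqVneq y z; last first.
  have [uniq' mem'] := sweep_cons lt_kn s_uniq s_mem sUY yU.
  exists [:: y, x k & s], u, (U :\ y), z; split=> //; split=> //=.
  - by rewrite s_path e_sym (reach y k) // eyk.
  - exact: leqW.
  - by rewrite !inE eq_sym neq_yz.
  - exact: reach zU le_uk ezu.
have [w [wU neq_wy ewk]] : exists w, [/\ w \in U, w != y & e w (x k)].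
  have := card_queue feasU lt_kn; rewrite (cardsD1 y) inE yU eyk ltnS.
  by case/card_gt0P=> w /setD1P [neq_wy]; rewrite inE => /andP [wU ewk]; exists w.
(* Reversal brings [x u] to the front, where [y = z] links it to [x k.+1]; [x k] becomes the far
   end. *)
pose t := rev (x k :: s).
have def_t : t = x u :: rev (belast (x k) s).
  by rewrite /t lastI rev_rcons s_last.
have t_uniq : uniq t by rewrite rev_uniq.
have t_mem v : (v \in t) =
    [exists i : 'I_n, (i <= k) && (v == x i)] || (v \in Y :\: U).
  by rewrite mem_rev s_mem.
have [uniq' mem'] := sweep_cons lt_kn t_uniq t_mem sUY yU.
exists (y :: t), k, (U :\ y), w; split=> //; split=> //=.
- rewrite def_t /= e_sym (reach y u) ?eq_yz ?ezu //=.
  by rewrite -s_last rev_path (eq_path (e' := e)).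
- by rewrite /t rev_cons last_rcons.
- by rewrite !inE neq_wy.
- exact: reach wU (leqnn k) ewk.
Qed.

Lemma swept_all k : k < n -> swept k.
Proof.
elim: k => [|k IHk] lt_kn; first exact: swept0.
exact: swept_step (IHk (ltnW lt_kn)).
Qed.

Lemma sweep_cycle : exists c : seq T,
  [/\ 3 <= size c, ucycle e c
    & forall v, (v \in c) = [exists i : 'I_n, v == x i] || (v \in Y)].
Proof.
have lt_pn : n.-1 < n by rewrite prednK ?ltnSn // ltnW.
have [s [u [U [z [[s_path s_last le_un] s_uniq s_mem]]]]] := swept_all lt_pn.
move=> [sUY cardU _] [zU ezu ezn].
(* Only the reserve is left, and it closes the cycle. *)
have /cards1P [z' def_U] : #|U| == 1 by rewrite cardU; apply/eqP; lia.
move: zU; rewrite {}def_U inE in sUY s_mem * => /eqP eq_z; subst z'.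
have zY : z \in Y by rewrite sub1set in sUY.
have all_le v : [exists i : 'I_n, (i <= n.-1) && (v == x i)] =
    [exists i : 'I_n, v == x i].
  by apply: eq_existsb => i; rewrite -ltnS prednK ?ltn_ord // ltnW.
have c_mem v : (v \in [:: z, x n.-1 & s]) =
    [exists i : 'I_n, v == x i] || (v \in Y).
  rewrite in_cons s_mem all_le !inE.
  by have [->|_] := eqVneq v z; rewrite ?zY ?orbT.
exists [:: z, x n.-1 & s]; split=> //.
(* An empty [s] would leave no place for [x 0], which differs from [z] and, as [n > 1], from
   [x n.-1]. *)
- case: s s_path s_last s_uniq s_mem c_mem => [|//] _ _ _ _ c_mem.
  have := c_mem (x 0); rewrite !inE (_ : [exists i, _]) /=; last first.
    by apply/existsP; exists (Ordinal (ltnW n_gt1)).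
  case/orP=> /eqP x0.
    by move: (xY (ltnW n_gt1)); rewrite x0 zY.
  have /x_inj : x 0 = x n.-1 by [].
  by rewrite !inE lt_pn (ltnW n_gt1) => /(_ isT isT); lia.
- apply/andP; split; first by rewrite /= rcons_path s_path s_last ezn e_sym ezu.
  rewrite cons_uniq s_uniq andbT s_mem !inE eqxx /= orbF.
  apply/existsPn=> i; rewrite negb_and; apply/orP; right.
  by apply: contraNneq (xY (ltn_ord i)) => <-.
Qed.

End Sweep.

Theorem theorem3 (G : sgraph) (X Y : {set G}) (x : 'I_#|X| -> G)
    (Gconn : connected G) (Gconvex : convex_bipartite Y x)
    (GA : propertyA Y x) :
  hamiltonian G.
Proof.
have [[covers disj _] [x_inj x_img] conv] := Gconvex.
have [sparse _ [cardN cardN']] := GA.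
have [v0 _] : exists v : G, v \in [set: G].
  by apply/card_gt0P; rewrite cardsT; case: Gconn.
(* The default [v0] is never reached for indices below [#|X|]. *)
pose x' k := nth v0 (codom x) k.
have x'E (i : 'I_#|X|) : x' i = x i.
  by rewrite /x' codomE (nth_map i) ?nth_ord_enum // size_enum_ord.
have XintE p q i : (x i \in Xint x p q) = (p <= i.+1 <= q).
  by rewrite mem_imset // inE.
have Xint_sub p q : Xint x p q \subset Xint x 1 #|X|.
  by apply/subsetP=> _ /imsetP [i _ ->]; rewrite XintE ltn_ord.
have NclosedY : Nclosed Y x 1 #|X| = Y.
  apply/setP=> y; rewrite inE; have [yY /= | //] := boolP (y \in Y).
  by have [p [q ->]] := conv y yY; rewrite Xint_sub.
have card_Y : #|Y| = #|X| by rewrite -[RHS]cardN NclosedY.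
(* Condition (3) thus gives every vertex of [Y] degree at least 2. *)
have NprimeY : Nprime Y x 1 #|X| = Y.
  apply/eqP; rewrite eqEcard cardN' card_Y leqnn andbT.
  by apply/subsetP=> y; rewrite inE => /andP [].
have deg2 y : y \in Y -> 1 < #|neighborhood y :&: Xint x 1 #|X| |.
  by rewrite -{1}NprimeY inE => /andP [].
have n_gt0 : 0 < #|X|.
  rewrite lt0n; apply/eqP=> X0.
  have /setP/(_ v0) := covers; rewrite !inE.
  by rewrite (cards0_eq X0) (cards0_eq (etrans card_Y X0)) !inE.
have n_gt1 : 1 < #|X|.
  have /card_gt0P [y yY] : 0 < #|Y| by rewrite card_Y.
  apply: leq_trans (deg2 y yY) _.
  apply: leq_trans (subset_leq_card (subsetIr _ _)) _.
  by rewrite -[in leqRHS]x_img; apply/subset_leq_card/imsetS/subsetP.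
have withinN p q : within (@edge G) #|X| x' Y p q \subset Nclosed Y x p.+1 q.+1.
  apply/subsetP=> y /withinP [yY y_le]; rewrite inE yY /=; apply/subsetP=> u.
  have [p' [q' def_N]] := conv y yY; move=> uN; have := uN.
  rewrite {1}def_N => /imsetP [i _ def_u]; move: uN; rewrite {}def_u inE => eyi.
  by rewrite XintE !ltnS y_le ?ltn_ord // x'E.
have xX i : x i \in X by rewrite -[in X in _ \in X]x_img imset_f.
have [||||y i j k yY||p q le_pq lt_qn neq|c [c_size c_cycle c_mem]] :=
  @sweep_cycle G (@edge G) #|X| x' Y.
- exact: edge_sym.
- exact: n_gt1.
- move=> i lt_in; rewrite (x'E (Ordinal lt_in)).
  by move/disjointFr: disj => ->.
- move=> i j lt_in lt_jn; rewrite (x'E (Ordinal lt_in)) (x'E (Ordinal lt_jn)).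
  by move/x_inj => [].
- move=> /andP [le_ij le_jk] lt_kn.
  have lt_jn := leq_ltn_trans le_jk lt_kn; have lt_in := leq_ltn_trans le_ij lt_jn.
  rewrite (x'E (Ordinal lt_in)) (x'E (Ordinal lt_jn)) (x'E (Ordinal lt_kn)).
  have [p [q def_N]] := conv y yY.
  have edgeE l : edge y (x l) = (p <= l.+1 <= q) by rewrite -XintE -def_N inE.
  by rewrite !edgeE /=; lia.
- exact: card_Y.
- have [lt_pq | ge_pq] := ltnP p q.
    rewrite (leq_trans (subset_leq_card (withinN p q))) // -subSS.
    by apply: sparse => // -[p0 def_q]; apply: neq; rewrite p0 -def_q.
  (* Condition (1) does not cover [p = q]; here the degree bound makes [within] empty. *)
  have {ge_pq} eq_qp : q = p by apply/eqP; rewrite eqn_leq ge_pq.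
  rewrite {}eq_qp {le_pq neq} subnn leqn0 in lt_qn *.
  rewrite cards_eq0 -subset0; apply/subsetP=> y yW.
  have := subsetP (withinN p p) y yW; rewrite inE => /andP [yY sub].
  suff: #|neighborhood y :&: Xint x 1 #|X| | <= 1 by rewrite leqNgt deg2.
  rewrite -(cards1 (x' p)) subset_leq_card // subIset //.
  rewrite (subset_trans sub) //; apply/subsetP=> _ /imsetP [i + ->].
  by rewrite !inE => le_ip; rewrite (_ : p = i) ?x'E //; lia.
- exists c; split=> // v; rewrite c_mem; have: v \in X :|: Y by rewrite covers inE.
  rewrite inE -[in X in X -> _]x_img => /orP [/imsetP [i _ ->]|->]; last exact: orbT.
  by apply/orP; left; apply/existsP; exists i; rewrite x'E.
Qed.
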